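(* Let $(J,W)$ be a graphon such that the (pseudo)metric space $(J,r_W)$ has packing dimension $d$. Then for every $0<\varepsilon<1$, $(J,W)$ has an ultra-strong regularity partition with error $\varepsilon$ and with at most $\varepsilon^{-O(\varepsilon^{-d})}$ classes (the implied constant not depending on $\varepsilon$).
   Context: A graphon is a pair $(J,W)$ with $J$ a standard probability space (measure $\pi$) and $W:J\times J\to[0,1]$ symmetric measurable; $r_W(x,y)=\int_J|W(x,z)-W(y,z)|\,dz$. The packing dimension of $(J,r_W)$ is $\limsup_{\varepsilon\to0}\log N(\varepsilon)/\log(1/\varepsilon)$, where $N(\varepsilon)$ is the maximum number of points mutually at distance at least $\varepsilon$. For a partition $\mathcal{P}$ of $J$ into measurable sets of positive measure, with $S(x)$ the class containing $x$, $W_{\mathcal{P}}(x,y)=\frac{1}{\pi(S(x))\pi(S(y))}\int_{S(x)\times S(y)}W$. $\mathcal{P}$ is an ultra-strong regularity partition with error $\varepsilon$ if $\|W-W_{\mathcal{P}}\|_1=\int_{J\times J}|W-W_{\mathcal{P}}|\le\varepsilon$. *)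

(* Defs.v *)
From HB Require Import structures.
From mathcomp Require Import all_boot all_order all_algebra.
From mathcomp Require Import all_classical all_reals all_analysis.
Import Order.TTheory GRing.Theory Num.Theory.
Import numFieldNormedType.Exports.

Set Implicit Arguments.
Unset Strict Implicit.
Unset Printing Implicit Defensive.

Local Open Scope classical_set_scope.
Local Open Scope ring_scope.

(* Standardness in the sense of Lebesgue and Rokhlin: off a null set N, f is an
   isomorphism between the completion of P and the completion of the Borel
   probability measure f_*P on the real line. Its inverse is measurable for the
   completions because f maps measurable subsets of ~` N to Borel sets up to a
   negligible set; A := ~` N shows that the image of ~` N has full measure.
   Both standard Borel probability spaces and complete Lebesgue-Rokhlin spaces
   satisfy this. *)
Definition standard_probability (R : realType) (dJ : measure_display)
    (J : measurableType dJ) (P : probability J R) : Prop :=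
  exists (N : set J) (f : J -> R),
    [/\ measurable N, P N = 0%E,
        measurable_fun [set: J] f,
        {in ~` N &, injective f} &
        forall A : set J, measurable A -> A `<=` ~` N ->
          exists2 B : set R, measurable B &
            negligible (pushforward P f) ((f @` A) `+` B)].

Record graphon (R : realType) (dJ : measure_display) (J : measurableType dJ)
    (P : probability J R) (W : J * J -> R) : Prop := Graphon {
  graphon_standard : standard_probability P ;
  graphon_measurable : measurable_fun [set: J * J] W ;
  graphon_sym : forall x y, W (x, y) = W (y, x) ;
  graphon_bounds : forall z, 0 <= W z <= 1
}.

Section GraphonNotions.
Context (R : realType) (dJ : measure_display) (J : measurableType dJ).
Implicit Types (P : probability J R) (W : J * J -> R).

Definition graphon_dist P W (x y : J) : R :=
  \int[P]_(z in [set: J]) `|W (x, z) - W (y, z)|.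

(* The value is +oo when there are arbitrarily large eps-separated families.
   For 0 < eps and r x x = 0 such a family p is automatically injective. *)
Definition packing_number (T : Type) (r : T -> T -> R) (eps : R) : \bar R :=
  ereal_sup [set n%:R%:E | n in
    [set n : nat | exists p : 'I_n -> T,
       forall i j, i != j -> eps <= r (p i) (p j)]].

Definition packing_dimension (T : Type) (r : T -> T -> R) : \bar R :=
  limf_esup (fun eps : R => lne (packing_number r eps) / (ln eps^-1)%:E)%E
            (0 : R)^'+.

(* A partition is the set of its classes. *)
Definition measurable_partition P (PP : set (set J)) : Prop :=
  partition PP id [set: J] /\
  forall S, PP S -> measurable S /\ (0 < P S)%E.

Definition partition_class (PP : set (set J)) (x : J) : set J :=
  [set y | exists S, [/\ PP S, S x & S y]].

Definition stepping P W (PP : set (set J)) (z : J * J) : R :=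
  let Sx := partition_class PP z.1 in
  let Sy := partition_class PP z.2 in
  (fine (P Sx) * fine (P Sy))^-1 *
  \int[(P \x P)%E]_(t in Sx `*` Sy) W t.

Definition ultra_strong_partition P W (PP : set (set J)) (eps : R) : Prop :=
  measurable_partition P PP /\
  (\int[P \x P]_(z in [set: J * J]) `|W z - stepping P W PP z|%:E <= eps%:E)%E.

End GraphonNotions.

(* Main.v *)
Require Import Defs.
From mathcomp Require Import all_boot all_order all_algebra.
From mathcomp Require Import all_classical all_reals all_analysis.
From mathcomp Require Import measurable_realfun lra ring.

(** A maximal [eta]-separated set of points is an [eta]-net, so [J] splits into
    at most [N(eta)] cells of diameter at most [2 eta]; null cells are merged
    into a cell of positive measure, which changes nothing almost everywhere.
    Averaging [W] over the cells first in one variable and then, by symmetry, in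
    the other moves it by at most [2 eta] in L1 each time. Hence with [eta]
    proportional to [eps] there is an ultra-strong partition with
    [N(eta) <= eta^-(d+1)] classes. As [d >= 0], this is below the required
    bound for [eps <= 1/2]; for larger [eps], where the bound may force a
    single class, the trivial partition works because a function with values in
    [0, 1] has mean absolute deviation at most [1/2]. *)

Import Order.TTheory GRing.Theory Num.Theory.
Import numFieldNormedType.Exports.

Set Implicit Arguments.
Unset Strict Implicit.
Unset Printing Implicit Defensive.

Local Open Scope classical_set_scope.
Local Open Scope ring_scope.

(** * Averaging against a doubly stochastic kernel *)

Section CurriedTonelli.
Local Open Scope ereal_scope.
Context (R : realType) (d1 d2 : measure_display).
Context (T1 : measurableType d1) (T2 : measurableType d2).
Variables (P1 : probability T1 R) (P2 : probability T2 R).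
Variable f : T1 -> T2 -> \bar R.
Hypothesis mf : measurable_fun [set: T1 * T2] (fun t => f t.1 t.2).
Hypothesis f0 : forall x y, 0 <= f x y.

Lemma measurable_curried_integral :
  measurable_fun setT (fun x => \int[P2]_y f x y).
Proof. exact: (measurable_fun_fubini_tonelli_F _ mf). Qed.

Lemma curried_tonelli_prod :
  \int[P1 \x P2]_z f z.1 z.2 = \int[P1]_x \int[P2]_y f x y.
Proof. exact: (fubini_tonelli1 _ mf). Qed.

Lemma curried_tonelli :
  \int[P1]_x \int[P2]_y f x y = \int[P2]_y \int[P1]_x f x y.
Proof. exact: (fubini_tonelli _ mf). Qed.

End CurriedTonelli.

Section Averaging.
Local Open Scope ereal_scope.
Context (R : realType) (dJ : measure_display) (J : measurableType dJ).
Variables (P : probability J R) (W : J * J -> R) (k : J -> J -> \bar R).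
Hypothesis mW : measurable_fun [set: J * J] W.
Hypothesis symW : forall x y, W (x, y) = W (y, x).
Hypothesis mk : measurable_fun [set: J * J] (fun z => k z.1 z.2).
Hypothesis k0 : forall x y, 0 <= k x y.
Hypothesis kl : forall x, \int[P]_y k x y = 1.
Hypothesis kr : forall y, \int[P]_x k x y = 1.

Definition gap x y x' y' : \bar R := `|W (x, y) - W (x', y')|%:E.

Lemma gap_ge0 x y x' y' : 0 <= gap x y x' y'. Proof. by rewrite lee_fin. Qed.
#[local] Hint Resolve gap_ge0 : core.

Lemma measurable_gap d (T : measurableType d) (f g h i : T -> J) :
  measurable_fun setT f -> measurable_fun setT g ->
  measurable_fun setT h -> measurable_fun setT i ->
  measurable_fun setT (fun t => gap (f t) (g t) (h t) (i t)).
Proof.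
move=> mf mg mh mi; apply/measurable_EFinP; apply: measurableT_comp => //.
by apply: measurable_funB; apply: measurableT_comp => //;
  apply: measurable_fun_pair.
Qed.

Lemma measurable_fun_comp2 d (T : measurableType d) (f g : T -> J) :
  measurable_fun setT f -> measurable_fun setT g ->
  measurable_fun setT (fun t => k (f t) (g t)).
Proof.
move=> mf mg; apply: (measurableT_comp mk (g := fun t => (f t, g t))).
exact: measurable_fun_pair.
Qed.

Ltac measurable_coord := repeat first
  [ exact: measurable_cst | exact: measurable_id
  | exact: measurable_fst | exact: measurable_snd
  | apply: (measurableT_comp measurable_fst)
  | apply: (measurableT_comp measurable_snd) ].

Ltac measurable_gaps := repeat lazymatch goal with
  | |- measurable_fun _ (fun t => (@?f t * @?g t)%E) => apply: emeasurable_funM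
  | |- measurable_fun _ (fun t => (@?f t + @?g t)%E) => apply: emeasurable_funD
  | |- measurable_fun _ (fun t => k (@?f t) (@?g t)) =>
    apply: measurable_fun_comp2; measurable_coord
  | |- measurable_fun _ (fun t => k _ (@?g t)) =>
    apply: measurable_fun_comp2; measurable_coord
  | |- measurable_fun _ (fun t => gap (@?f t) (@?g t) (@?h t) (@?i t)) =>
    apply: measurable_gap; measurable_coord
  | |- measurable_fun _ (k _) =>
    apply: measurable_fun_comp2; measurable_coord
  | |- measurable_fun _ (gap _ _ _) =>
    apply: measurable_gap; measurable_coord
  end.

(** Mean change of [W] when the first coordinate moves from [x] to a point drawn with density [k x]
    while [y] stays fixed. *)
Definition avg_gap x y : \bar R := \int[P]_x' (k x x' * gap x y x' y).

Lemma avg_gap_ge0 x y : 0 <= avg_gap x y.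
Proof. by apply: integral_ge0 => x' _; rewrite mule_ge0. Qed.
#[local] Hint Resolve avg_gap_ge0 : core.

Lemma measurable_avg_gap d (T : measurableType d) (f g : T -> J) :
  measurable_fun setT f -> measurable_fun setT g ->
  measurable_fun setT (fun t => avg_gap (f t) (g t)).
Proof.
move=> mf mg; apply: (measurableT_comp (f := fun z => avg_gap z.1 z.2)
  (g := fun t => (f t, g t))); last exact: measurable_fun_pair.
apply: measurable_curried_integral => [|t x']; last by rewrite mule_ge0.
by measurable_gaps.
Qed.

Ltac measurability := measurable_gaps; lazymatch goal with
  | |- measurable_fun _ (fun t => avg_gap (@?f t) (@?g t)) =>
    apply: measurable_avg_gap; measurable_coord
  | |- measurable_fun _ (avg_gap _) =>
    apply: measurable_avg_gap; measurable_coord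
  end.

(** Cost of the second move, from [(x', y)] to [(x', y')], averaged over [x']. By symmetry of [W] it
    is a first-coordinate move at [(y, x')], hence the swapped arguments of [avg_gap]. *)
Definition avg2_gap x y : \bar R := \int[P]_x' (k x x' * avg_gap y x').

Lemma avg2_gap_ge0 x y : 0 <= avg2_gap x y.
Proof. by apply: integral_ge0 => x' _; rewrite mule_ge0. Qed.
#[local] Hint Resolve avg2_gap_ge0 : core.

Lemma measurable_avg2_gap :
  measurable_fun [set: J * J] (fun z => avg2_gap z.1 z.2).
Proof.
apply: measurable_curried_integral => [|t x']; last by rewrite mule_ge0.
by measurability.
Qed.

(** Integrating over [x] first, the factor [k x x'] disappears because the columns of [k] have
    integral 1; what remains is the integral of [avg_gap y x']. *)
Lemma integral_avg2_gap :
  \int[P]_x \int[P]_y avg2_gap x y = \int[P]_x \int[P]_y avg_gap x y.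
Proof.
rewrite (curried_tonelli P P measurable_avg2_gap avg2_gap_ge0).
apply: eq_integral => y _.
rewrite (@curried_tonelli _ _ _ _ _ P P (fun x x' => k x x' * avg_gap y x'));
  first last.
- by move=> *; rewrite mule_ge0.
- by measurability.
apply: eq_integral => x' _.
by rewrite ge0_integralZr ?kr ?mul1e//; measurability.
Qed.

Definition averaged_difference x y : \bar R :=
  \int[P]_x' \int[P]_y' (k x x' * k y y' * gap x y x' y').

Lemma averaged_difference_ge0 x y : 0 <= averaged_difference x y.
Proof. by do 2 apply: integral_ge0 => ? _; rewrite !mule_ge0. Qed.
#[local] Hint Resolve averaged_difference_ge0 : core.

Lemma measurable_averaged_difference :
  measurable_fun [set: J * J] (fun z => averaged_difference z.1 z.2).
Proof.
apply: measurable_curried_integral => [|t x']; last first.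
  by apply: integral_ge0 => ? _; rewrite !mule_ge0.
apply: measurable_curried_integral => [|t y']; last first.
  by rewrite !mule_ge0.
by measurability.
Qed.

(* Moving from [(x, y)] to [(x', y')] one coordinate at a time, and using the
   symmetry of [W] for the second coordinate. *)
Lemma averaged_difference_le x y :
  averaged_difference x y <= avg_gap x y + avg2_gap x y.
Proof.
have kD0 a b c e u v : 0 <= k a b * gap c e u v by rewrite mule_ge0.
have kF0 a b c e : 0 <= k a b * avg_gap c e by rewrite mule_ge0.
have mkD : measurable_fun setT (fun x' => k x x' * gap x y x' y).
  by measurable_gaps.
have mkF : measurable_fun setT (fun x' => k x x' * avg_gap y x').
  by measurability.
rewrite /avg2_gap -(ge0_integralD P measurableT
  (fun x' _ => kD0 x x' x y x' y) mkD (fun x' _ => kF0 x x' y x') mkF).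
apply: ge0_le_integral; first exact: measurableT.
- by move=> ? _; apply: integral_ge0 => ? _; rewrite !mule_ge0.
- apply: measurable_curried_integral => [|t y']; first by measurable_gaps.
  by rewrite !mule_ge0.
- exact: emeasurable_funD.
move=> x' _.
have mkl : measurable_fun setT (fun y' => k y y') by measurable_gaps.
have mDk : measurable_fun setT (fun y' => gap x y x' y * k y y').
  by measurable_gaps.
have mkD' : measurable_fun setT (fun y' => k y y' * gap y x' y' x').
  by measurable_gaps.
have Dk0 y' : setT y' -> 0 <= gap x y x' y * k y y' by rewrite mule_ge0.
have kD0' y' : setT y' -> 0 <= k y y' * gap y x' y' x' by [].
have mDkD := emeasurable_funD mDk mkD'.
have DkD0 y' : setT y' -> 0 <= gap x y x' y * k y y' + k y y' * gap y x' y' x'.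
  by move=> *; apply: adde_ge0; [exact: Dk0|exact: kD0'].
(* The first gap does not depend on [y'], so the row integral of [k y] being 1 lets it enter the
   integral over [y']. Both sides can then be compared pointwise. *)
have -> : k x x' * gap x y x' y + k x x' * avg_gap y x' =
    \int[P]_y' (k x x' * (gap x y x' y * k y y' + k y y' * gap y x' y' x')).
  rewrite [RHS](ge0_integralZl P measurableT mDkD DkD0 (k0 x x')).
  rewrite [X in _ = _ * X](ge0_integralD P measurableT Dk0 mDk kD0' mkD').
  rewrite [X in _ = _ * (X + _)](ge0_integralZl P measurableT mkl
    (fun y' _ => k0 y y') (gap_ge0 x y x' y)).
  by rewrite kl mule1 (ge0_muleDr _ (gap_ge0 _ _ _ _) (avg_gap_ge0 _ _)).
apply: ge0_le_integral; first exact: measurableT.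
- by move=> ? _; rewrite !mule_ge0.
- by measurable_gaps.
- by measurable_gaps.
move=> y' _; rewrite -muleA; apply: lee_wpmul2l; first exact: k0.
rewrite [gap x y x' y * _]muleC.
rewrite -(ge0_muleDr _ (gap_ge0 _ _ _ _) (gap_ge0 _ _ _ _)).
apply: lee_wpmul2l; first exact: k0.
(* Triangle inequality through the intermediate value [W (x', y)]. *)
rewrite -EFinD lee_fin (symW y) (symW y'); apply: (le_trans _ (ler_normD _ _)).
by rewrite addrA subrK.
Qed.

(** Both moves have the same total cost by [integral_avg2_gap], and that cost is at most [delta].
    The factor [k x x'] in the hypothesis restricts the distance bound to pairs that the kernel
    connects. *)
Lemma integral_averaged_difference (delta : \bar R) : 0 <= delta ->
  {ae P, forall x, {ae P, forall x',
    k x x' * (\int[P]_y `|W (x, y) - W (x', y)|%:E) <= k x x' * delta}} ->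
  \int[P \x P]_z averaged_difference z.1 z.2 <= delta + delta.
Proof.
move=> delta0 H.
have mF' : measurable_fun [set: J * J] (fun z => avg_gap z.1 z.2).
  by measurability.
have Fdelta : \int[P]_x \int[P]_y avg_gap x y <= delta.
  have -> : delta = \int[P]__ delta.
    by rewrite integral_cst//= [P _]probability_setT mule1.
  apply: ae_ge0_le_integral; first exact: measurableT.
  - by move=> x _; apply: integral_ge0.
  - by apply: measurable_curried_integral => // *; exact: avg_gap_ge0.
  - by [].
  - exact: measurable_cst.
  apply: filterS H => x H _ /=.
  have mkD : measurable_fun [set: J * J]
    (fun t => k x t.2 * gap x t.1 t.2 t.1) by measurable_gaps.
  have kD0 y x' : 0 <= k x x' * gap x y x' y by rewrite mule_ge0.
  (* With [y] innermost, the inner integral becomes [k x x'] times the distance from [x] to [x']. *)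
  rewrite (curried_tonelli P P mkD kD0).
  have -> : delta = \int[P]_x' (k x x' * delta).
    by rewrite ge0_integralZr// ?kl ?mul1e//; measurable_gaps.
  apply: ae_ge0_le_integral; first exact: measurableT.
  - by move=> x' _; apply: integral_ge0 => y _; exact: kD0.
  - by apply: measurable_curried_integral => //; measurable_gaps.
  - by move=> x' _; rewrite mule_ge0.
  - by apply: emeasurable_funM; [measurable_gaps|exact: measurable_cst].
  apply: filterS H => x' H _; apply: le_trans H.
  by rewrite ge0_integralZl//; measurable_gaps.
have FF2 : \int[P \x P]_z averaged_difference z.1 z.2 <=
    \int[P \x P]_z (avg_gap z.1 z.2 + avg2_gap z.1 z.2).
  apply: ge0_le_integral; first exact: measurableT.
  - by move=> *; exact: averaged_difference_ge0.
  - exact: measurable_averaged_difference.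
  - exact: emeasurable_funD mF' measurable_avg2_gap.
  - by move=> *; exact: averaged_difference_le.
apply: (le_trans FF2).
rewrite (ge0_integralD _ measurableT (fun z _ => avg_gap_ge0 z.1 z.2) mF'
  (fun z _ => avg2_gap_ge0 z.1 z.2) measurable_avg2_gap).
rewrite (curried_tonelli_prod _ _ mF' avg_gap_ge0).
rewrite (curried_tonelli_prod _ _ measurable_avg2_gap avg2_gap_ge0).
by rewrite integral_avg2_gap leeD.
Qed.

End Averaging.

(** * Finite measurable labellings *)

Lemma integrable_of_bounded d (T : measurableType d) (R : realType)
    (mu : {measure set T -> \bar R}) (D : set T) (f : T -> R) (M : R) :
  measurable D -> (mu D < +oo)%E -> measurable_fun setT f ->
  (forall x, `|f x| <= M) -> mu.-integrable D (EFin \o f).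
Proof.
move=> mD Dfin mf fM; apply: measurable_bounded_integrable => //.
  exact: measurable_funTS.
by exists M; split => [|N /ltW MN x _]; [exact: num_real|exact: le_trans MN].
Qed.

(** The left side is the absolute value of the mean of [r - f]; the bound [M] supplies the
    integrability needed to split the integral. *)
Lemma dist_mean_le d (T : measurableType d) (R : realType)
    (mu : {measure set T -> \bar R}) (D : set T) (f : T -> R) (M r : R) :
  measurable D -> (0 < mu D < +oo)%E -> measurable_fun setT f ->
  (forall x, `|f x| <= M) ->
  `|r - (fine (mu D))^-1 * \int[mu]_(t in D) f t| <=
  (fine (mu D))^-1 * \int[mu]_(t in D) `|r - f t|.
Proof.
move=> mD /andP[D0 Dfin] mf fM.
have c0 : 0 < fine (mu D) by rewrite fine_gt0// D0.
have mcst : measurable_fun [set: T] (cst r) by exact: measurable_cst.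
have -> : r - (fine (mu D))^-1 * \int[mu]_(t in D) f t =
    (fine (mu D))^-1 * \int[mu]_(t in D) (r - f t).
  rewrite RintegralB ?Rintegral_cst//; last 2 first.
  - exact: (@integrable_of_bounded _ _ _ _ _ _ `|r|).
  - exact: integrable_of_bounded fM.
  by rewrite mulrBr mulrCA mulVf ?mulr1// gt_eqF.
have ci0 : 0 < (fine (mu D))^-1 by rewrite invr_gt0.
rewrite normrM (gtr0_norm ci0) (ler_pM2l ci0).
apply: le_normr_Rintegral => //.
apply: (@integrable_of_bounded _ _ _ _ _ _ (`|r| + M)) => //.
  exact: measurable_funB.
by move=> x; rewrite (le_trans (ler_normB _ _))// lerD2l.
Qed.

Section FiniteLabelling.
Context d (J : measurableType d) (T : finType).
Variable q : J -> T.
Hypothesis mq : forall t, measurable (q @^-1` [set t]).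

Lemma measurable_labelling_preimage (A : set T) : measurable (q @^-1` A).
Proof.
have -> : q @^-1` A = \bigcup_(t in A) q @^-1` [set t].
  by apply/seteqP; split => [x Ax|x [t At] /= ->//]; first by exists (q x).
by apply: fin_bigcup_measurable => //; exact: finite_finset.
Qed.

(** Every subset of the finite label type has a measurable preimage, so whatever factors through the
    labels is measurable. *)
Lemma measurable_fun_labelling d' (U : measurableType d') (g : T -> U) :
  measurable_fun setT (g \o q).
Proof.
move=> _ Y mY; rewrite setTI.
exact: (measurable_labelling_preimage (g @^-1` Y)).
Qed.

End FiniteLabelling.

Lemma measurable_labelling_pair d (J : measurableType d) (T : finType)
    (q : J -> T) : (forall t, measurable (q @^-1` [set t])) ->
  forall t : T * T,
    measurable ((fun z : J * J => (q z.1, q z.2)) @^-1` [set t]).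
Proof.
move=> mq [s t].
rewrite (_ : _ @^-1` _ = (q @^-1` [set s]) `*` (q @^-1` [set t])).
  exact: measurableX.
by apply/seteqP; split => [[x y] [<- <-]//|[x y] [/= -> ->]].
Qed.

(** * The partition into fibres of a labelling and its averaging kernel *)

Section Fibres.
Context (R : realType) (d : measure_display) (J : measurableType d).
Variables (P : probability J R) (T : finType) (q : J -> T).
Hypothesis mq : forall t, measurable (q @^-1` [set t]).
Hypothesis q_gt0 : forall x, (0 < P (q @^-1` [set q x]))%E.

(** Indexed by points rather than by labels, so that empty fibres are not classes. *)
Definition fibres : set (set J) := range (fun x => q @^-1` [set q x]).

Lemma partition_class_fibres x :
  partition_class fibres x = q @^-1` [set q x].
Proof.
apply/seteqP; split => [y [_ [[z _ <-] /= -> ->]]//|y /= qyx].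
by exists (q @^-1` [set q x]); split => //; exists x.
Qed.

Lemma measurable_partition_fibres : measurable_partition P fibres.
Proof.
split; last first.
  by move=> _ [x _ <-]; split => //; exact: measurable_labelling_preimage.
split.
- apply/seteqP; split => // x _; exists (q @^-1` [set q x]) => //.
  by exists x.
- by move=> _ _ [x _ <-] [y _ <-] [z [/= <- ->]].
- by move=> _ [x _ <-]; exists x.
Qed.

Lemma card_fibres : exists2 k, (fibres #= `I_k)%card & (k <= #|T|)%N.
Proof.
have fibresT : fibres `<=` (fun t => q @^-1` [set t]) @` [set: T].
  by move=> _ [x _ <-]; exists (q x).
have rank_inj : {in [set: T] &, injective (fun t => nat_of_ord (enum_rank t))}.
  by move=> s t _ _ /val_inj/enum_rank_inj.
have TI : ([set: T] #<= `I_#|T|)%card.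
  rewrite -(card_le_eql (inj_card_eq rank_inj)); apply: subset_card_le.
  by move=> _ [t _ <-] /=.
have fibresI : (fibres #<= `I_#|T|)%card.
  apply: card_le_trans (subset_card_le fibresT) _.
  exact: card_le_trans (card_image_le _ _) TI.
have [k kE] : exists k, (fibres #= `I_k)%card.
  by apply/finite_setP/finite_set_leP; exists #|T|.
by exists k => //; rewrite -card_le_II -(card_le_eql kE).
Qed.

(** Density with respect to [P] of a random point of the class of [x], that is, the kernel of
    conditional expectation onto the partition. The boolean multiple [*+] acts as an indicator. *)
Definition fibre_kernel x y : \bar R :=
  ((fine (P (q @^-1` [set q x])))^-1 *+ (q x == q y))%:E.

Lemma fibre_kernel_ge0 x y : (0 <= fibre_kernel x y)%E.
Proof. by rewrite lee_fin mulrn_wge0// invr_ge0 fine_ge0. Qed.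

Lemma fibre_kernelC x y : fibre_kernel x y = fibre_kernel y x.
Proof. by rewrite /fibre_kernel eq_sym; case: eqP => // ->. Qed.

Lemma measurable_fibre_kernel :
  measurable_fun [set: J * J] (fun z => fibre_kernel z.1 z.2).
Proof.
exact: (measurable_fun_labelling (measurable_labelling_pair mq)
  (fun t => ((fine (P (q @^-1` [set t.1])))^-1 *+ (t.1 == t.2))%:E)).
Qed.

Lemma fine_fibre_gt0 x : 0 < fine (P (q @^-1` [set q x])).
Proof.
by rewrite fine_gt0// q_gt0/= (le_lt_trans (probability_le1 _ _)) ?ltry.
Qed.

Lemma integral_fibre_kernel x : (\int[P]_y fibre_kernel x y = 1)%E.
Proof.
set A := q @^-1` [set q x]; have mA : measurable A by exact: mq.
rewrite (_ : fibre_kernel x = fun y => ((fine (P A))^-1%:E * (\1_A y)%:E)%E).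
  rewrite ge0_integralZl ?lee_fin ?invr_ge0 ?fine_ge0//; last first.
    by apply/measurable_EFinP; exact: measurable_indic.
  rewrite integral_indic// setIT -[X in (_ * X)%E]fineK ?fin_num_measure//.
  by rewrite -EFinM mulVf// gt_eqF// fine_fibre_gt0.
apply/funext => y; rewrite /fibre_kernel indicE -EFinM mulr_natr.
congr (_ *+ _)%:E; congr nat_of_bool.
by apply/eqP/idP; rewrite inE /A/= => ->.
Qed.

Section Step.
Variable W : J * J -> R.
Hypothesis mW : measurable_fun [set: J * J] W.
Hypothesis W01 : forall z, 0 <= W z <= 1.

Let normW z : `|W z| <= 1.
Proof. by have /andP[W0 W1] := W01 z; rewrite ger0_norm. Qed.

(** The step value is the mean of [W] over the block of [z], so [dist_mean_le] bounds the difference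
    by a mean over that block, which is exactly the average against the two kernels. *)
Lemma dist_stepping_fibres_le z :
  (`|W z - stepping P W fibres z|%:E <=
   averaged_difference P W fibre_kernel z.1 z.2)%E.
Proof.
case: z => x y; rewrite /stepping !partition_class_fibres/=.
set A := q @^-1` [set q x]; set B := q @^-1` [set q y].
have mA : measurable A by exact: mq.
have mB : measurable B by exact: mq.
have mAB : measurable (A `*` B) by exact: measurableX.
have PAB : (P \x P)%E (A `*` B) = (fine (P A) * fine (P B))%:E.
  by rewrite product_measure1E// EFinM !fineK// fin_num_measure.
have c0 : 0 < fine (P A) * fine (P B) by rewrite mulr_gt0// fine_fibre_gt0.
have ABfin : ((P \x P)%E (A `*` B) < +oo)%E by rewrite PAB ltry.
have := @dist_mean_le _ _ _ (P \x P)%E _ W 1 (W (x, y)) mAB _ mW normW.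
rewrite /= PAB lte_fin c0 ltry/= => /(_ isT); rewrite -lee_fin.
move=> /le_trans; apply.
rewrite EFinM /Rintegral fineK; last first.
  apply: integrable_fin_num => //.
  apply: (@integrable_of_bounded _ _ _ (P \x P)%E _ _ 2) => //.
    apply: measurableT_comp => //; apply: measurable_funB => //.
  by move=> t; rewrite normr_id (le_trans (ler_normB _ _))// lerD.
have mdW : measurable_fun [set: J * J] (fun t => `|W (x, y) - W t|%:E).
  apply/measurable_EFinP; apply: measurableT_comp => //.
  by apply: measurable_funB.
rewrite -ge0_integralZl ?lee_fin ?invr_ge0 ?(ltW c0)//;
  last exact: measurable_funTS.
(* Once the block integral is extended by zero, the integrands agree pointwise: the product of the
   two kernels is the normalised indicator of [A] times [B]. *)
rewrite integral_mkcond /averaged_difference -curried_tonelli_prod/=.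
- rewrite le_eqVlt; apply/orP; left; apply/eqP.
  apply: eq_integral => -[x' y'] _; rewrite patchE /fibre_kernel /gap/= -/A -/B.
  rewrite -!EFinM invfM; case: ifPn => [|] ; rewrite ?inE ?notin_setE/= /A /B/=.
    by move=> [-> ->]; rewrite !eqxx.
  move=> nAB; case: eqP => [qx|]; case: eqP => [qy|];
    rewrite ?mulr0n ?mulr0 ?mul0r//.
  by exfalso; apply: nAB; rewrite qx qy.
- have mk := measurable_fibre_kernel.
  have mkx u (f : J * J -> J) : measurable_fun setT f ->
      measurable_fun setT (fun t => fibre_kernel u (f t)).
    by move=> mf; apply: (measurable_fun_comp2 mk) => //; exact: measurable_cst.
  apply: emeasurable_funM; first by apply: emeasurable_funM; exact: mkx.
  by apply: measurable_gap => //; exact: measurable_cst.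
- by move=> x' y'; rewrite !mule_ge0 ?fibre_kernel_ge0 ?gap_ge0//.
Qed.

Lemma measurable_stepping_fibres :
  measurable_fun [set: J * J] (stepping P W fibres).
Proof.
pose g (t : T * T) : R :=
  (fine (P (q @^-1` [set t.1])) * fine (P (q @^-1` [set t.2])))^-1 *
  \int[(P \x P)%E]_(z in q @^-1` [set t.1] `*` q @^-1` [set t.2]) W z.
have -> : stepping P W fibres = fun z => g (q z.1, q z.2).
  by apply/funext => z; rewrite /stepping !partition_class_fibres.
exact: (measurable_fun_labelling (measurable_labelling_pair mq) g).
Qed.

Hypothesis symW : forall x y, W (x, y) = W (y, x).

Lemma ultra_strong_partition_fibres (delta : R) : 0 <= delta ->
  {ae P, forall x, {ae P, forall y,
    q x = q y -> graphon_dist P W x y <= delta}} ->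
  ultra_strong_partition P W fibres (delta + delta).
Proof.
move=> delta0 H; split; first exact: measurable_partition_fibres.
have k1 y : (\int[P]_x fibre_kernel x y = 1)%E.
  by under eq_integral do rewrite fibre_kernelC; exact: integral_fibre_kernel.
have := @integral_averaged_difference _ _ _ P W fibre_kernel mW symW
  measurable_fibre_kernel fibre_kernel_ge0 integral_fibre_kernel k1 delta%:E.
rewrite lee_fin => /(_ delta0) avg; apply: le_trans (avg _); last first.
  apply: filterS H => x; apply: filterS => y.
  (* Points with equal labels are close by hypothesis; for different labels the kernel vanishes. *)
  have [qxy /(_ qxy)|/eqP/negPf qxy _] := pselect (q x = q y).
    rewrite -lee_fin /graphon_dist /Rintegral fineK; last first.
      apply: integrable_fin_num => //.
      apply: (@integrable_of_bounded _ _ _ P _ _ 2) => //.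
      - exact: (le_lt_trans (probability_le1 P measurableT)) (ltry _).
      - apply: measurableT_comp => //; apply: measurable_funB;
          exact: measurableT_comp mW (pair1_measurable _).
      - by move=> z; rewrite normr_id (le_trans (ler_normB _ _))// lerD.
    by move=> *; apply: lee_wpmul2l => //; exact: fibre_kernel_ge0.
  by rewrite /fibre_kernel qxy !mul0e.
apply: ge0_le_integral => //.
- apply/measurable_EFinP; apply: measurableT_comp => //.
  by apply: measurable_funB => //; exact: measurable_stepping_fibres.
- exact: measurable_averaged_difference mW measurable_fibre_kernel
    fibre_kernel_ge0.
- by move=> z _; apply: dist_stepping_fibres_le.
Qed.

End Step.
End Fibres.

(** * Separated nets and cells *)

Section Packing.
Context (R : realType) (T : Type).
Variable r : T -> T -> R.

Definition pairwise_separated (eps : R) n (p : 'I_n -> T) :=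
  forall i j, i != j -> eps <= r (p i) (p j).

(** A single point is a separated family, so the packing number is at least 1 and the quotient of
    logarithms is nonnegative at scales below 1. *)
Lemma packing_dimension_ge0 : T -> (0 <= packing_dimension r)%E.
Proof.
move=> x; rewrite /packing_dimension leNgt; apply/negP => /ereal_inf_lt.
move=> [_ [V V0 <-]]; rewrite ltNge => /negP; apply.
have [e [Ve e0 e1]] : exists e : R, [/\ V e, 0 < e & e < 1].
  apply: (@filter_ex _ (0 : R)^'+); near=> e; split; near: e => //.
  - exact: nbhs_right_gt.
  - exact: nbhs_right_lt.
apply: (le_trans _ (ereal_sup_ubound (imageP _ Ve))).
have L0 : 0 < ln e^-1 by rewrite ln_gt0// invf_gt1.
rewrite inver gt_eqF// lee_pdivlMr// mul0e lne_ge0.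
apply: ereal_sup_ubound; exists 1%N => //; exists (fun=> x) => i j.
by rewrite !ord1.
Unshelve. all: by end_near. Qed.

Lemma packing_dimension_lt (a : R) : (packing_dimension r < a%:E)%E ->
  exists2 delta : R, 0 < delta <= 1 & forall eps, 0 < eps < delta ->
    forall n (p : 'I_n -> T), pairwise_separated eps p -> n%:R <= eps `^ (- a).
Proof.
move=> /ereal_inf_lt[_ [V V0 <-] Va].
have [e /= e0 eV] : \forall e \near 0^'+, V e by [].
(* Staying below 1 keeps [ln eps^-1] positive, so that the bound on the quotient can be multiplied
   out. *)
exists (Order.min e 1); first by rewrite lt_min e0 ltr01 ge_min lexx orbT.
move=> eps /andP[eps0]; rewrite lt_min => /andP[epse eps1] n p sep.
have Veps : V eps.
  by apply: eV => //=; rewrite sub0r normrN gtr0_norm.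
have L0 : 0 < ln eps^-1 by rewrite ln_gt0// invf_gt1.
have := le_lt_trans (ereal_sup_ubound (imageP _ Veps)) Va.
rewrite inver gt_eqF// lte_pdivrMr// -EFinM => Na.
(* The empty family is set apart because the real logarithm below needs a positive size. *)
case: n p sep => [|n] p sep; first exact: powR_ge0.
have : (lne n.+1%:R%:E <= lne (packing_number r eps))%E.
  have nN : (n.+1%:R%:E <= packing_number r eps)%E.
    by apply: ereal_sup_ubound; exists n.+1 => //; exists p.
  rewrite lee_lne//= in_itv/= leey andbT ?lee_fin//.
  by rewrite (le_trans _ nN)// lee_fin.
move=> /le_lt_trans/(_ Na); rewrite lne_EFin ?ltr0n// lte_fin => /ltW nL.
rewrite /powR gt_eqF// -[leLHS]lnK ?posrE ?ltr0n// ler_expR.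
by rewrite (le_trans nL)// lnV ?posrE// mulNr mulrN.
Qed.

Hypothesis rC : forall x y, r x y = r y x.

(** A separated family of maximal size is a net: a point at distance at least [eps] from all its
    members could be adjoined. *)
Lemma exists_separated_net (eps M : R) :
  (forall n (p : 'I_n -> T), pairwise_separated eps p -> n%:R <= M) ->
  exists n (p : 'I_n -> T), pairwise_separated eps p /\
    forall x, exists i, r x (p i) < eps.
Proof.
move=> bound.
pose sep n := `[< exists p : 'I_n -> T, pairwise_separated eps p >].
have sep0 : exists n, sep n.
  exists 0%N; apply/asboolP.
  by exists (fun i : 'I_0 => match notF (ltn_ord i) with end) => -[].
have sepM n : sep n -> (n <= Num.truncn M)%N.
  move=> /asboolP[p /bound nM].
  by rewrite truncn_ge_nat// (le_trans _ nM).
have [n /asboolP[p pP] nmax] := ex_maxnP sep0 sepM.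
exists n, p; split => // x; apply/not_existsP => far.
have /nmax : sep n.+1; last by rewrite ltnn.
(* The enlarged family puts [x] at index 0 and shifts [p] by one. *)
apply/asboolP; exists (fun j => oapp p x (unlift ord0 j)) => i j.
have far' k : eps <= r x (p k) by rewrite leNgt; apply/negP/far.
case: (unliftP ord0 i) => [i' ->|->]; case: (unliftP ord0 j) => [j' ->|->] //=.
- by rewrite (inj_eq lift_inj) => /pP.
- by rewrite rC.
Qed.

End Packing.

(** * Absorbing null cells *)

Section Merging.
Context (R : realType) (d : measure_display) (J : measurableType d).
Variables (P : probability J R) (T : finType) (q : J -> T).
Hypothesis mq : forall t, measurable (q @^-1` [set t]).

Lemma negligible_null_labels :
  P (q @^-1` [set t | P (q @^-1` [set t]) = 0%E]) = 0%E.
Proof.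
have -> : q @^-1` [set t | P (q @^-1` [set t]) = 0%E] =
    \bigcup_(t in [set t | P (q @^-1` [set t]) = 0%E]) q @^-1` [set t].
  by apply/seteqP; split => [x Ax|x [t At] /= ->//]; first by exists (q x).
rewrite measure_fin_bigcup//; first by rewrite fsbig1.
  exact: finite_finset.
by move=> s t _ _ [x [/= <- <-]].
Qed.

Lemma merge_null_fibres : exists q' : J -> T,
  [/\ forall t, measurable (q' @^-1` [set t]),
      forall x, (0 < P (q' @^-1` [set q' x]))%E &
      {ae P, forall x, q' x = q x}].
Proof.
(* If all fibres were null, the whole probability space would be null. *)
have [t0 Pt0] : exists t, (0 < P (q @^-1` [set t]))%E.
  apply: contrapT => /forallNP nP.
  have := negligible_null_labels; rewrite (_ : _ @^-1` _ = setT).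
    by rewrite probability_setT => /eqP; rewrite onee_eq0.
  apply/seteqP; split => // x _ /=; apply/eqP; rewrite eq_le measure_ge0 andbT.
  by rewrite leNgt; apply/negP/nP.
pose phi t := if (0 < P (q @^-1` [set t]))%E then t else t0.
have phi_gt0 t : (0 < P (q @^-1` [set phi t]))%E by rewrite /phi; case: ifP.
have phiK t : phi (phi t) = phi t by rewrite {1}/phi phi_gt0.
have mphi t : measurable ((phi \o q) @^-1` [set t]).
  exact: (measurable_labelling_preimage mq (phi @^-1` [set t])).
exists (phi \o q); split => // [x|].
  (* As [phi] is idempotent, the merged fibre contains the original fibre of [phi (q x)], which has
     positive measure. *)
  apply: (lt_le_trans (phi_gt0 (q x))); rewrite le_measure ?inE//.
  by move=> y /= ->.
exists (q @^-1` [set t | P (q @^-1` [set t]) = 0%E]); split.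
- exact: measurable_labelling_preimage.
- exact: negligible_null_labels.
move=> x /= phix; apply/eqP; rewrite eq_le measure_ge0 andbT leNgt.
by apply/negP => q0; apply: phix; rewrite /phi q0.
Qed.

End Merging.

(** * The pseudometric of a graphon and its small cells *)

Section GraphonDist.
Context (R : realType) (d : measure_display) (J : measurableType d).
Variables (P : probability J R) (W : J * J -> R).
Hypothesis mW : measurable_fun [set: J * J] W.
Hypothesis W01 : forall z, 0 <= W z <= 1.

Lemma graphon_distC x y : graphon_dist P W x y = graphon_dist P W y x.
Proof. by apply: eq_Rintegral => z _; rewrite distrC. Qed.

Lemma integrable_graphon_dist x y :
  P.-integrable setT (EFin \o (fun z => `|W (x, z) - W (y, z)|)).
Proof.
apply: (@integrable_of_bounded _ _ _ P _ _ 2) => //.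
- exact: (le_lt_trans (probability_le1 P measurableT)) (ltry _).
- apply: measurableT_comp => //; apply: measurable_funB;
    exact: measurableT_comp mW (pair1_measurable _).
- have nW z : `|W z| <= 1 by have /andP[W0 W1] := W01 z; rewrite ger0_norm.
  by move=> z; rewrite normr_id (le_trans (ler_normB _ _))// lerD.
Qed.

Lemma graphon_dist_triangle x y z :
  graphon_dist P W x z <= graphon_dist P W x y + graphon_dist P W y z.
Proof.
rewrite /graphon_dist -RintegralD//; [|exact: integrable_graphon_dist..].
apply: le_Rintegral => //; first exact: integrable_graphon_dist.
  have := integrableD measurableT (integrable_graphon_dist x y)
    (integrable_graphon_dist y z).
  by apply: eq_integrable.
by move=> t _; exact: ler_distD.
Qed.

Lemma measurable_graphon_dist y :
  measurable_fun setT (fun x => graphon_dist P W x y).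
Proof.
rewrite /graphon_dist /Rintegral; apply: measurableT_comp => //.
apply: measurable_curried_integral => //.
by apply: measurable_gap => //; exact: measurable_cst.
Qed.

(* Voronoi-type cells around the centres, the label of a point being determined
   by the set of centres at distance less than [eps]. *)
Lemma exists_small_cells (n : nat) (p : 'I_n -> J) (eps : R) :
  (forall x, exists i, graphon_dist P W x (p i) < eps) ->
  exists q : J -> 'I_n, (forall i, measurable (q @^-1` [set i])) /\
    forall x y, q x = q y -> graphon_dist P W x y <= eps + eps.
Proof.
move=> net.
(* A default centre making [label] total; [labelP] shows that the default never occurs on actual
   points. *)
have [i0 _] := net point.
pose near_centres x := [ffun i => graphon_dist P W x (p i) < eps].
have mnc b : measurable (near_centres @^-1` [set b]).
  have -> : near_centres @^-1` [set b] =
      \bigcap_(i in [set: 'I_n])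
        [set x | (graphon_dist P W x (p i) < eps) = b i].
    apply/seteqP; split => [x /= <- i _|x bx /=]; first by rewrite ffunE.
    by apply/ffunP => i; rewrite ffunE bx.
  apply: fin_bigcap_measurable; first exact: finite_finset.
  move=> i _; rewrite -[X in measurable X]setTI.
  exact: (measurable_fun_ltr (measurable_graphon_dist (p i))
    (measurable_cst eps) measurableT (Y := [set b i])).
pose label (b : {ffun 'I_n -> bool}) := odflt i0 [pick i | b i].
have labelP x : graphon_dist P W x (p (label (near_centres x))) < eps.
  rewrite /label; case: pickP => [i|far]; first by rewrite ffunE.
  by have [i] := net x; have := far i; rewrite ffunE => ->.
exists (label \o near_centres); split => [i|x y /= xy].
  exact: (measurable_labelling_preimage mnc (label @^-1` [set i])).
apply: (le_trans (graphon_dist_triangle _ (p (label (near_centres x))) _)).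
rewrite lerD ?ltW// graphon_distC xy; exact: labelP.
Qed.

End GraphonDist.

(** * Regularity partitions *)

(** For [m] the mean of [f], integrating the chord bound gives [2 * m * (1 - m)], which is at most
    1/2 since [2 * m - 1] has a nonnegative square. *)
Lemma mean_absolute_deviation_le d (T : measurableType d) (R : realType)
    (mu : {measure set T -> \bar R}) (f : T -> R) :
  mu setT = 1%E -> measurable_fun setT f -> (forall x, 0 <= f x <= 1) ->
  (\int[mu]_x `|f x - \int[mu]_t f t|%:E <= 2^-1%:E)%E.
Proof.
move=> mu1 mf f01; set m := Rintegral _ _ _.
have muT : (mu setT < +oo)%E by rewrite mu1 ltry.
have intf : mu.-integrable setT (EFin \o f).
  apply: (@integrable_of_bounded _ _ _ _ _ _ 1) => // x.
  by have /andP[f0 f1] := f01 x; rewrite ger0_norm.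
have mfin : (\int[mu]_t (f t)%:E = m%:E)%E.
  by rewrite /m /Rintegral fineK//; exact: integrable_fin_num intf.
have m0 : 0 <= m by apply: Rintegral_ge0 => x _; case/andP: (f01 x).
have m1 : m <= 1.
  have := @le_Rintegral _ _ _ mu setT f (cst 1) measurableT intf.
  rewrite Rintegral_cst// mu1 mulr1; apply.
    by apply: (@integrable_of_bounded _ _ _ _ _ _ 1) => //= x; rewrite normr1.
  by move=> x _; case/andP: (f01 x).
(* On [0, 1] the convex function [y |-> |y - m|] lies below its chord. *)
have chord x : `|f x - m| <= (1 - m) * f x + m * (1 - f x).
  by have /andP[f0 f1] := f01 x; rewrite ler_norml; apply/andP; split; nra.
apply: (@le_trans _ _ (\int[mu]_x ((1 - m) * f x + m * (1 - f x))%:E)%E).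
  apply: ge0_le_integral => //.
  - apply/measurable_EFinP; apply: measurableT_comp => //.
    by apply: measurable_funB => //; exact: measurable_cst.
  - apply/measurable_EFinP; apply: measurable_funD.
      by apply: measurable_funM => //; exact: measurable_cst.
    apply: measurable_funM; first exact: measurable_cst.
    by apply: measurable_funB => //; exact: measurable_cst.
  - by move=> x _; rewrite lee_fin.
(* Affine form of the chord, ready for linearity of the integral. *)
have -> : (fun x => ((1 - m) * f x + m * (1 - f x))%:E) =
    fun x => (m%:E + (1 - 2 * m)%:E * (f x)%:E)%E.
  by apply/funext => x; rewrite -EFinM -EFinD; congr EFin; ring.
rewrite integralD//; last 2 first.
- by apply: (@integrable_of_bounded _ _ _ _ _ (cst m) `|m|).
- exact: integrableZl.
rewrite integral_cst// mu1 mule1 integralZl// mfin -EFinM -EFinD lee_fin.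
by have := sqr_ge0 (2 * m - 1); nra.
Qed.

Section RegularityPartitions.
Context (R : realType) (d : measure_display) (J : measurableType d).
Variables (P : probability J R) (W : J * J -> R).
Hypothesis graphonW : graphon P W.

Let mW := graphon_measurable graphonW.
Let W01 := graphon_bounds graphonW.
Let symW := graphon_sym graphonW.

(** With a single class, the stepping is the constant mean of [W] and the error is its mean absolute
    deviation on the product space. *)
Lemma trivial_ultra_strong_partition (eps : R) : 2^-1 <= eps ->
  ultra_strong_partition P W (fibres (fun _ : J => tt)) eps.
Proof.
move=> eps2; have q1 : (fun _ : J => tt) @^-1` [set tt] = setT.
  by apply/seteqP; split.
split.
  apply: measurable_partition_fibres => [[]|x]; rewrite q1//.
  by rewrite probability_setT.
have PT : P setT = 1%E := probability_setT P.
have PPT : (P \x P)%E setT = 1%E.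
  by rewrite -setXTT product_measure1E//= PT mule1.
have -> : stepping P W (fibres (fun=> tt)) =
    fun=> \int[(P \x P)%E]_(t in setT) W t.
  apply/funext => z; rewrite /stepping !partition_class_fibres q1 setXTT.
  by rewrite PT/= mulr1 invr1 mul1r.
apply: (le_trans (mean_absolute_deviation_le PPT mW W01)).
by rewrite lee_fin.
Qed.

(** Cells have diameter at most [2 * delta], and each of the two coordinates costs one diameter,
    hence the factor 4. Merging keeps the label type ['I_n], which bounds the number of classes. *)
Lemma net_ultra_strong_partition (n : nat) (p : 'I_n -> J) (delta : R) :
  0 < delta ->
  (forall x, exists i, graphon_dist P W x (p i) < delta) ->
  exists PP k, [/\ ultra_strong_partition P W PP (4 * delta),
    (PP #= `I_k)%card & (k <= n)%N].
Proof.
move=> delta0 net.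
have [q0 [mq0 q0P]] := exists_small_cells mW W01 net.
have [q [mq q_gt0 qq0]] := merge_null_fibres P mq0.
have [k kE kn] := card_fibres q.
exists (fibres q), k; split => //; last by rewrite card_ord in kn.
have -> : 4 * delta = (delta + delta) + (delta + delta) by ring.
apply: ultra_strong_partition_fibres => //; first by rewrite addr_ge0 ?ltW.
have aeq0 := qq0.
apply: filterS qq0 => x qx; apply: filterS aeq0 => y qy qxy.
by apply: q0P; rewrite -qx -qy.
Qed.

End RegularityPartitions.

(** * Real powers and the count of classes *)

Lemma powR_ge1 (R : realType) (eps a : R) :
  0 < eps <= 1 -> 0 <= a -> 1 <= eps `^ (- a).
Proof.
move=> /andP[eps0 eps1] a0; rewrite /powR gt_eqF// -expR0 ler_expR.
by rewrite mulNr -mulrN mulr_ge0// oppr_ge0 ln_le0.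
Qed.

Lemma powR_scale_le (R : realType) (c a : R) : 0 < c <= 1 -> 0 <= a ->
  exists2 C : R, a <= C & forall eps, 0 < eps <= 2^-1 ->
    (c * eps) `^ (- a) <= eps `^ (- C).
Proof.
move=> /andP[c0 c1] a0.
have l2 : 0 < ln (2 : R) by rewrite ln_gt0// ltr1n.
have lc : 0 <= - ln c by rewrite oppr_ge0 ln_le0.
(* For [eps] at most 1/2, [- ln eps] is at least [ln 2], so the constant [- ln c] is at most
   [- ln c / ln 2] times [- ln eps] and can be absorbed into the exponent. *)
exists (a + a * (- ln c / ln 2)).
  by rewrite lerDl mulr_ge0// divr_ge0// ltW.
move=> eps /andP[eps0 eps2].
have leps : ln 2 <= - ln eps.
  rewrite -lnV ?posrE// ler_ln ?posrE ?invr_gt0//.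
  by rewrite -[leLHS]invrK lef_pV2 ?posrE.
rewrite /powR !gt_eqF ?mulr_gt0// ler_expR lnM ?posrE//.
have : - ln c <= - ln c / ln 2 * - ln eps.
  by rewrite -mulrA ler_peMr// ler_pdivlMl// mulr1.
move=> /(ler_wpM2l a0); rewrite !mulNr !mulrN !mulrDr; lra.
Qed.

Theorem theorem5p8 (R : realType) (dJ : measure_display)
    (J : measurableType dJ) (P : probability J R) (W : J * J -> R) (d : R)
    (graphonW : graphon P W)
    (dimW : packing_dimension (graphon_dist P W) = d%:E) :
  exists2 C : R, 0 < C &
    forall eps : R, 0 < eps < 1 ->
      exists (PP : set (set J)) (k : nat),
        [/\ ultra_strong_partition P W PP eps,
            (PP #= `I_k)%card &
            k%:R <= eps `^ (- (C * eps `^ (- d)))].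
Proof.
have d0 : 0 <= d.
  by rewrite -lee_fin -dimW packing_dimension_ge0//; exact: point.
have [delta /andP[delta0 delta1] bound] :
    exists2 delta : R, 0 < delta <= 1 & forall eps, 0 < eps < delta ->
      forall n (p : 'I_n -> J), pairwise_separated (graphon_dist P W) eps p ->
      n%:R <= eps `^ (- (d + 1)).
  (* Any exponent above [d] would serve here: the excess only enlarges the constant [C]. *)
  by apply: packing_dimension_lt; rewrite dimW lte_fin ltrDl.
(* The net scale will be [delta / 4 * eps]: it lies below [delta], where [bound] applies, and four
   times it is [delta * eps], at most [eps]. *)
have c01 : 0 < delta / 4 <= 1 by apply/andP; split; lra.
have [C Cd CP] := powR_scale_le c01 (addr_ge0 d0 ler01).
have C0 : 0 < C by apply: lt_le_trans Cd; rewrite ltr_wpDl.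
exists C => // eps /andP[eps0 eps1].
have epsd : 1 <= eps `^ (- d) by apply: powR_ge1 d0; rewrite eps0 (ltW eps1).
have [eps2|/ltW eps2] := leP (2^-1) eps.
  have [k kE k1] := card_fibres (fun _ : J => tt).
  exists (fibres (fun _ : J => tt)), k; split => //.
    exact: trivial_ultra_strong_partition.
  apply: (@le_trans _ _ 1).
    by rewrite card_unit in k1; rewrite -[leRHS]/(1%:R) ler_nat.
  apply: powR_ge1; first by rewrite eps0 (ltW eps1).
  by rewrite mulr_ge0 ?(ltW C0) ?ltW// (lt_le_trans ltr01).
have eta0 : 0 < delta / 4 * eps by rewrite !mulr_gt0 ?invr_gt0.
have eta_lt : delta / 4 * eps < delta by nra.
have etaP : 0 < delta / 4 * eps < delta by rewrite eta0.
have [n [p [sep net]]] :=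
  exists_separated_net (@graphon_distC _ _ _ P W) (bound _ etaP).
have [PP [k [PPeps kE kn]]] := net_ultra_strong_partition graphonW eta0 net.
exists PP, k; split => //.
  case: PPeps => mPP le; split => //; apply: (le_trans le).
  by rewrite lee_fin; nra.
apply: (@le_trans _ _ (eps `^ (- C))).
  apply: le_trans (CP eps _); last by rewrite eps0.
  by apply: le_trans (bound _ etaP _ _ sep); rewrite ler_nat.
rewrite {1}/powR {1}/powR gt_eqF// ler_expR !mulNr -!mulrN.
by rewrite ler_wpM2r ?oppr_ge0 ?ln_le0 ?(ltW eps1)// ler_peMr// ltW.
Qed.
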